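(* The calculus $LS_{BBI}+C$ is sound and cut-free complete with respect to the cancellative commutative monoidal semantics for BBI: for every formula $F$, (i) if $\emptyset;\emptyset\vdash w:F$ is derivable in $LS_{BBI}+C$ (possibly with cut) for some label $w$, then $F$ is valid over all frames $(H,R,\epsilon)$ satisfying identity, commutativity, associativity and cancellativity; and (ii) if $F$ is valid over all such frames, then $\emptyset;\emptyset\vdash w:F$ is derivable in $LS_{BBI}+C$ without cut for some label variable $w$.
   Context: Formulae: $A ::= p \mid \top\mid\bot\mid\neg A\mid A\vee A\mid A\wedge A\mid A\to A\mid \top^*\mid A*A\mid A\mathrel{-\!\!*}A$, $p\in Var$. Semantics. A frame is $(H,R,\epsilon)$, $H$ nonempty, $R\subseteq H^3$, $\epsilon\in H$. Conditions (for all $h_i\in H$): (identity) $R(h_1,\epsilon,h_2)\iff h_1=h_2$; (commutativity) $R(h_1,h_2,h_3)\iff R(h_2,h_1,h_3)$; (associativity) $R(h_1,h_5,h_4)\wedge R(h_2,h_3,h_5)\Rightarrow\exists h_6\,(R(h_6,h_3,h_4)\wedge R(h_1,h_2,h_6))$; (cancellativity) $R(h_1,h_2,h_3)\wedge R(h_1,h_4,h_3)\Rightarrow h_2=h_4$. A model adds $\nu:Var\to\mathcal{P}(H)$; forcing: $h\Vdash p$ iff $h\in\nu(p)$; $\top$ always, $\bot$ never; $\neg,\wedge,\vee,\to$ classical; $h\Vdash\top^*$ iff $h=\epsilon$; $h\Vdash A*B$ iff $\exists h_1,h_2$ with $R(h_1,h_2,h)$, $h_1\Vdash A$, $h_2\Vdash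 B$; $h\Vdash A\mathrel{-\!\!*}B$ iff $\forall h_1,h_2$, $R(h,h_1,h_2)$ and $h_1\Vdash A$ imply $h_2\Vdash B$. Valid over a class = forced at every world of every model on a frame in the class. Calculus. Labels: $LVar\cup\{\epsilon\}$. Labelled formula $a:A$; relational atom $(a,b\triangleright c)$; sequent $\mathcal{G};\Gamma\vdash\Delta$ with $\mathcal{G}$ a set of relational atoms and $\Gamma,\Delta$ multisets of labelled formulae; $[y/x]$ ($x$ label variable) uniform replacement; $\neg A:=A\to\bot$, $A\vee B:=\neg A\to B$. $LS_{BBI}$ rules (fresh = label variable not in conclusion): $id$: axiom $\mathcal{G};\Gamma,w:p\vdash w:p,\Delta$; $cut$: $\mathcal{G};\Gamma\vdash x:A,\Delta$ and $\mathcal{G}';\Gamma',x:A\vdash\Delta'\Rightarrow\mathcal{G},\mathcal{G}';\Gamma,\Gamma'\vdash\Delta,\Delta'$; $\bot L$: axiom $\mathcal{G};\Gamma,w:\bot\vdash\Delta$; $\top R$: axiom $\mathcal{G};\Gamma\vdash w:\top,\Delta$; $\top^*R$: axiom $\mathcal{G};\Gamma\vdash\epsilon:\top^*,\Delta$; $\top^*L$: $(\epsilon,w\triangleright\epsilon),\mathcal{G};\Gamma\vdash\Delta\Rightarrow\mathcal{G};\Gamma,w:\top^*\vdash\Delta$; $\wedge L$: $\mathcal{G};\Gamma,w:A,w:B\vdash\Delta\Rightarrow\mathcal{G};\Gamma,w:A\wedge B\vdash\Delta$; $\wedge R$: $\mathcal{G};\Gamma\vdash w:A,\Delta$ and $\mathcal{G};\Gamma\vdash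 w:B,\Delta\Rightarrow\mathcal{G};\Gamma\vdash w:A\wedge B,\Delta$; $\to L$: $\mathcal{G};\Gamma\vdash w:A,\Delta$ and $\mathcal{G};\Gamma,w:B\vdash\Delta\Rightarrow\mathcal{G};\Gamma,w:A\to B\vdash\Delta$; $\to R$: $\mathcal{G};\Gamma,w:A\vdash w:B,\Delta\Rightarrow\mathcal{G};\Gamma\vdash w:A\to B,\Delta$; $*L$: $(x,y\triangleright z),\mathcal{G};\Gamma,x:A,y:B\vdash\Delta\Rightarrow\mathcal{G};\Gamma,z:A*B\vdash\Delta$ ($x,y$ fresh); $\mathrel{-\!\!*}R$: $(x,z\triangleright y),\mathcal{G};\Gamma,x:A\vdash y:B,\Delta\Rightarrow\mathcal{G};\Gamma\vdash z:A\mathrel{-\!\!*}B,\Delta$ ($x,y$ fresh); $*R$: $(x,y\triangleright z),\mathcal{G};\Gamma\vdash x:A,z:A*B,\Delta$ and $(x,y\triangleright z),\mathcal{G};\Gamma\vdash y:B,z:A*B,\Delta\Rightarrow(x,y\triangleright z),\mathcal{G};\Gamma\vdash z:A*B,\Delta$; $\mathrel{-\!\!*}L$: $(x,y\triangleright z),\mathcal{G};\Gamma,y:A\mathrel{-\!\!*}B\vdash x:A,\Delta$ and $(x,y\triangleright z),\mathcal{G};\Gamma,y:A\mathrel{-\!\!*}B,z:B\vdash\Delta\Rightarrow(x,y\triangleright z),\mathcal{G};\Gamma,y:A\mathrel{-\!\!*}B\vdash\Delta$; $E$: $(y,x\triangleright z),(x,y\triangleright z),\mathcal{G};\Gamma\vdash\Delta\Rightarrow(x,y\triangleright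 z),\mathcal{G};\Gamma\vdash\Delta$; $A$: $(u,w\triangleright z),(y,v\triangleright w),(x,y\triangleright z),(u,v\triangleright x),\mathcal{G};\Gamma\vdash\Delta\Rightarrow(x,y\triangleright z),(u,v\triangleright x),\mathcal{G};\Gamma\vdash\Delta$ ($w$ fresh); $U$: $(x,\epsilon\triangleright x),\mathcal{G};\Gamma\vdash\Delta\Rightarrow\mathcal{G};\Gamma\vdash\Delta$; $A_C$: $(x,w\triangleright x),(y,y\triangleright w),(x,y\triangleright x),\mathcal{G};\Gamma\vdash\Delta\Rightarrow(x,y\triangleright x),\mathcal{G};\Gamma\vdash\Delta$ ($w$ fresh); $Eq_1$: $(\epsilon,w'\triangleright w'),\mathcal{G}[w'/w];\Gamma[w'/w]\vdash\Delta[w'/w]\Rightarrow(\epsilon,w\triangleright w'),\mathcal{G};\Gamma\vdash\Delta$; $Eq_2$: same premise $\Rightarrow(\epsilon,w'\triangleright w),\mathcal{G};\Gamma\vdash\Delta$. $LS_{BBI}+C$ adds $C$: $(x,y\triangleright z),\mathcal{G}[y/w];\Gamma[y/w]\vdash\Delta[y/w]\Rightarrow(x,y\triangleright z),(x,w\triangleright z),\mathcal{G};\Gamma\vdash\Delta$. In $Eq_1,Eq_2,C$, $w$ must be a label variable.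
   Formalization: In (i), ''some label w'' is restricted to label variables: for w = ε the claim fails, since ε:⊤* is an axiom but ⊤* is not valid. The two fresh labels x, y in *L and −*R are required to be distinct, as the rules are unsound otherwise. *)

(* Defs.v *)
From Stdlib Require Import List Permutation Arith.
Import ListNotations.
Set Implicit Arguments.

Inductive form (Var : Type) : Type :=
| FAtom  : Var -> form Var
| FTop   : form Var
| FBot   : form Var
| FNeg   : form Var -> form Var
| FOr    : form Var -> form Var -> form Var
| FAnd   : form Var -> form Var -> form Var
| FImp   : form Var -> form Var -> form Var
| FEmp   : form Var                               (* top-star *)
| FStar  : form Var -> form Var -> form Var
| FWand  : form Var -> form Var -> form Var.

Arguments FTop {Var}.
Arguments FBot {Var}.
Arguments FEmp {Var}.

(* In [frame_rel h1 h2 h3] the last argument is the composite.  Nonemptiness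
   of [world] is witnessed by [frame_eps]. *)
Record frame : Type := Frame {
  world     : Type;
  frame_rel : world -> world -> world -> Prop;
  frame_eps : world
}.

Definition frame_identity (M : frame) : Prop :=
  forall h1 h2 : world M, frame_rel M h1 (frame_eps M) h2 <-> h1 = h2.

Definition frame_commutativity (M : frame) : Prop :=
  forall h1 h2 h3 : world M, frame_rel M h1 h2 h3 <-> frame_rel M h2 h1 h3.

Definition frame_associativity (M : frame) : Prop :=
  forall h1 h2 h3 h4 h5 : world M,
    frame_rel M h1 h5 h4 /\ frame_rel M h2 h3 h5 ->
    exists h6 : world M, frame_rel M h6 h3 h4 /\ frame_rel M h1 h2 h6.

Definition frame_cancellativity (M : frame) : Prop :=
  forall h1 h2 h3 h4 : world M,
    frame_rel M h1 h2 h3 /\ frame_rel M h1 h4 h3 -> h2 = h4.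

Definition cancellative_frame (M : frame) : Prop :=
  frame_identity M /\ frame_commutativity M /\
  frame_associativity M /\ frame_cancellativity M.

Fixpoint forces (Var : Type) (M : frame) (nu : Var -> world M -> Prop)
    (h : world M) (F : form Var) {struct F} : Prop :=
  match F with
  | FAtom p   => nu p h
  | FTop      => True
  | FBot      => False
  | FNeg A    => ~ forces M nu h A
  | FOr A B   => forces M nu h A \/ forces M nu h B
  | FAnd A B  => forces M nu h A /\ forces M nu h B
  | FImp A B  => forces M nu h A -> forces M nu h B
  | FEmp      => h = frame_eps M
  | FStar A B => exists h1 h2 : world M,
      frame_rel M h1 h2 h /\ forces M nu h1 A /\ forces M nu h2 B
  | FWand A B => forall h1 h2 : world M,
      frame_rel M h h1 h2 -> forces M nu h1 A -> forces M nu h2 B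
  end.

Definition valid_cancellative (Var : Type) (F : form Var) : Prop :=
  forall M : frame, cancellative_frame M ->
  forall (nu : Var -> world M -> Prop) (h : world M), forces M nu h F.

(* The calculus treats negation and disjunction as abbreviations, so its
   sequents are built from the formulae without these two connectives. *)
Inductive cform (Var : Type) : Type :=
| CAtom  : Var -> cform Var
| CTop   : cform Var
| CBot   : cform Var
| CAnd   : cform Var -> cform Var -> cform Var
| CImp   : cform Var -> cform Var -> cform Var
| CEmp   : cform Var
| CStar  : cform Var -> cform Var -> cform Var
| CWand  : cform Var -> cform Var -> cform Var.

Arguments CTop {Var}.
Arguments CBot {Var}.
Arguments CEmp {Var}.

Definition CNeg (Var : Type) (A : cform Var) : cform Var := CImp A CBot.
Definition COr (Var : Type) (A B : cform Var) : cform Var := CImp (CNeg A) B.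

Fixpoint unabbrev (Var : Type) (F : form Var) : cform Var :=
  match F with
  | FAtom p   => CAtom p
  | FTop      => CTop
  | FBot      => CBot
  | FNeg A    => CNeg (unabbrev A)
  | FOr A B   => COr (unabbrev A) (unabbrev B)
  | FAnd A B  => CAnd (unabbrev A) (unabbrev B)
  | FImp A B  => CImp (unabbrev A) (unabbrev B)
  | FEmp      => CEmp
  | FStar A B => CStar (unabbrev A) (unabbrev B)
  | FWand A B => CWand (unabbrev A) (unabbrev B)
  end.

(* Label variables are a countably infinite supply of names. *)
Definition lvar : Type := nat.

Inductive label : Type :=
| LVar : lvar -> label
| LEps : label.

Inductive ratom : Type := RAtom : label -> label -> label -> ratom.

Notation "⟨ a , b ▷ c ⟩" := (RAtom a b c) (at level 0, a, b, c at level 99).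

Definition lform (Var : Type) : Type := (label * cform Var)%type.

(* [subst_* y w] is the replacement [y/w]. *)
Definition subst_label (y : label) (w : lvar) (l : label) : label :=
  match l with
  | LVar v => if Nat.eqb v w then y else LVar v
  | LEps   => LEps
  end.

Definition subst_ratom (y : label) (w : lvar) (r : ratom) : ratom :=
  match r with
  | RAtom a b c =>
      RAtom (subst_label y w a) (subst_label y w b) (subst_label y w c)
  end.

Definition subst_lform (Var : Type) (y : label) (w : lvar) (f : lform Var)
    : lform Var := (subst_label y w (fst f), snd f).

Definition in_ratom (l : label) (r : ratom) : Prop :=
  match r with RAtom a b c => l = a \/ l = b \/ l = c end.

Definition fresh (Var : Type) (x : lvar) (G : list ratom)
    (Γ Δ : list (lform Var)) : Prop :=
  (forall r, In r G -> ~ in_ratom (LVar x) r) /\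
  (forall f, In f Γ -> fst f <> LVar x) /\
  (forall f, In f Δ -> fst f <> LVar x).

(* [LSBBI_C true] is LS_BBI + C with cut and [LSBBI_C false] is LS_BBI + C
   without cut.  Lists stand for finite sets (relational atoms) and finite
   multisets (labelled formulae): [r_repr] makes derivability independent of
   the representing lists.  The two fresh labels of [r_starL] and [r_wandR]
   must be distinct: the rules are unsound otherwise. *)
Inductive LSBBI_C (Var : Type) (with_cut : bool) :
    list ratom -> list (lform Var) -> list (lform Var) -> Prop :=
| r_repr : forall G G' Γ Γ' Δ Δ',
    (forall r, In r G <-> In r G') -> Permutation Γ Γ' -> Permutation Δ Δ' ->
    LSBBI_C with_cut G Γ Δ ->
    LSBBI_C with_cut G' Γ' Δ'
| r_id : forall G Γ Δ w p,
    LSBBI_C with_cut G ((w, CAtom p) :: Γ) ((w, CAtom p) :: Δ)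
| r_cut : forall G G' Γ Γ' Δ Δ' x A,
    with_cut = true ->
    LSBBI_C with_cut G Γ ((x, A) :: Δ) ->
    LSBBI_C with_cut G' ((x, A) :: Γ') Δ' ->
    LSBBI_C with_cut (G ++ G') (Γ ++ Γ') (Δ ++ Δ')
| r_botL : forall G Γ Δ w,
    LSBBI_C with_cut G ((w, CBot) :: Γ) Δ
| r_topR : forall G Γ Δ w,
    LSBBI_C with_cut G Γ ((w, CTop) :: Δ)
| r_empR : forall G Γ Δ,
    LSBBI_C with_cut G Γ ((LEps, CEmp) :: Δ)
| r_empL : forall G Γ Δ w,
    LSBBI_C with_cut (⟨LEps, w ▷ LEps⟩ :: G) Γ Δ ->
    LSBBI_C with_cut G ((w, CEmp) :: Γ) Δ
| r_andL : forall G Γ Δ w A B,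
    LSBBI_C with_cut G ((w, A) :: (w, B) :: Γ) Δ ->
    LSBBI_C with_cut G ((w, CAnd A B) :: Γ) Δ
| r_andR : forall G Γ Δ w A B,
    LSBBI_C with_cut G Γ ((w, A) :: Δ) ->
    LSBBI_C with_cut G Γ ((w, B) :: Δ) ->
    LSBBI_C with_cut G Γ ((w, CAnd A B) :: Δ)
| r_impL : forall G Γ Δ w A B,
    LSBBI_C with_cut G Γ ((w, A) :: Δ) ->
    LSBBI_C with_cut G ((w, B) :: Γ) Δ ->
    LSBBI_C with_cut G ((w, CImp A B) :: Γ) Δ
| r_impR : forall G Γ Δ w A B,
    LSBBI_C with_cut G ((w, A) :: Γ) ((w, B) :: Δ) ->
    LSBBI_C with_cut G Γ ((w, CImp A B) :: Δ)
| r_starL : forall G Γ Δ (x y : lvar) z A B,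
    x <> y ->
    fresh x G ((z, CStar A B) :: Γ) Δ ->
    fresh y G ((z, CStar A B) :: Γ) Δ ->
    LSBBI_C with_cut (⟨LVar x, LVar y ▷ z⟩ :: G)
      ((LVar x, A) :: (LVar y, B) :: Γ) Δ ->
    LSBBI_C with_cut G ((z, CStar A B) :: Γ) Δ
| r_wandR : forall G Γ Δ (x y : lvar) z A B,
    x <> y ->
    fresh x G Γ ((z, CWand A B) :: Δ) ->
    fresh y G Γ ((z, CWand A B) :: Δ) ->
    LSBBI_C with_cut (⟨LVar x, z ▷ LVar y⟩ :: G)
      ((LVar x, A) :: Γ) ((LVar y, B) :: Δ) ->
    LSBBI_C with_cut G Γ ((z, CWand A B) :: Δ)
| r_starR : forall G Γ Δ x y z A B,
    LSBBI_C with_cut (⟨x, y ▷ z⟩ :: G) Γ ((x, A) :: (z, CStar A B) :: Δ) ->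
    LSBBI_C with_cut (⟨x, y ▷ z⟩ :: G) Γ ((y, B) :: (z, CStar A B) :: Δ) ->
    LSBBI_C with_cut (⟨x, y ▷ z⟩ :: G) Γ ((z, CStar A B) :: Δ)
| r_wandL : forall G Γ Δ x y z A B,
    LSBBI_C with_cut (⟨x, y ▷ z⟩ :: G) ((y, CWand A B) :: Γ) ((x, A) :: Δ) ->
    LSBBI_C with_cut (⟨x, y ▷ z⟩ :: G) ((y, CWand A B) :: (z, B) :: Γ) Δ ->
    LSBBI_C with_cut (⟨x, y ▷ z⟩ :: G) ((y, CWand A B) :: Γ) Δ
| r_E : forall G Γ Δ x y z,
    LSBBI_C with_cut (⟨y, x ▷ z⟩ :: ⟨x, y ▷ z⟩ :: G) Γ Δ ->
    LSBBI_C with_cut (⟨x, y ▷ z⟩ :: G) Γ Δ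
| r_A : forall G Γ Δ x y z u v (w : lvar),
    fresh w (⟨x, y ▷ z⟩ :: ⟨u, v ▷ x⟩ :: G) Γ Δ ->
    LSBBI_C with_cut
      (⟨u, LVar w ▷ z⟩ :: ⟨y, v ▷ LVar w⟩ :: ⟨x, y ▷ z⟩ :: ⟨u, v ▷ x⟩ :: G)
      Γ Δ ->
    LSBBI_C with_cut (⟨x, y ▷ z⟩ :: ⟨u, v ▷ x⟩ :: G) Γ Δ
| r_U : forall G Γ Δ x,
    LSBBI_C with_cut (⟨x, LEps ▷ x⟩ :: G) Γ Δ ->
    LSBBI_C with_cut G Γ Δ
| r_AC : forall G Γ Δ x y (w : lvar),
    fresh w (⟨x, y ▷ x⟩ :: G) Γ Δ ->
    LSBBI_C with_cut
      (⟨x, LVar w ▷ x⟩ :: ⟨y, y ▷ LVar w⟩ :: ⟨x, y ▷ x⟩ :: G) Γ Δ ->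
    LSBBI_C with_cut (⟨x, y ▷ x⟩ :: G) Γ Δ
| r_Eq1 : forall G Γ Δ (w : lvar) w',
    LSBBI_C with_cut (⟨LEps, w' ▷ w'⟩ :: map (subst_ratom w' w) G)
      (map (subst_lform w' w) Γ) (map (subst_lform w' w) Δ) ->
    LSBBI_C with_cut (⟨LEps, LVar w ▷ w'⟩ :: G) Γ Δ
| r_Eq2 : forall G Γ Δ (w : lvar) w',
    LSBBI_C with_cut (⟨LEps, w' ▷ w'⟩ :: map (subst_ratom w' w) G)
      (map (subst_lform w' w) Γ) (map (subst_lform w' w) Δ) ->
    LSBBI_C with_cut (⟨LEps, w' ▷ LVar w⟩ :: G) Γ Δ
| r_C : forall G Γ Δ x y z (w : lvar),
    LSBBI_C with_cut (⟨x, y ▷ z⟩ :: map (subst_ratom y w) G)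
      (map (subst_lform y w) Γ) (map (subst_lform y w) Δ) ->
    LSBBI_C with_cut (⟨x, y ▷ z⟩ :: ⟨x, LVar w ▷ z⟩ :: G) Γ Δ.

(* Main.v *)
Require Import Defs.
From Stdlib Require Import List Permutation Arith Lia Classical ClassicalEpsilon.
From Stdlib Require Import FunctionalExtensionality PropExtensionality ProofIrrelevance.
Import ListNotations.
Set Implicit Arguments.

(** Completeness: in backward proof search, an underivable sequent always has an
    underivable premise, so every rule instance can eventually be treated while
    staying underivable.  This gives an infinite sequence of sequents linked by
    label maps, which are identities except at the steps Eq1, Eq2 and C that merge
    two labels.  The direct limit of the labels along these maps, with the union
    of the relational atoms, is a cancellative frame: each frame condition is
    what saturation under the corresponding structural rule provides.  It
    satisfies all left formulae and refutes all right formulae.  Taking the limit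
    avoids any admissibility result (weakening, contraction, substitution) for
    the calculus. *)

(** * Forcing for the formulae of the calculus *)

Fixpoint cforces (Var : Type) (M : frame) (nu : Var -> world M -> Prop)
    (h : world M) (A : cform Var) {struct A} : Prop :=
  match A with
  | CAtom p   => nu p h
  | CTop      => True
  | CBot      => False
  | CAnd A B  => cforces M nu h A /\ cforces M nu h B
  | CImp A B  => cforces M nu h A -> cforces M nu h B
  | CEmp      => h = frame_eps M
  | CStar A B => exists h1 h2 : world M,
      frame_rel M h1 h2 h /\ cforces M nu h1 A /\ cforces M nu h2 B
  | CWand A B => forall h1 h2 : world M,
      frame_rel M h h1 h2 -> cforces M nu h1 A -> cforces M nu h2 B
  end.

Lemma cforces_unabbrev (Var : Type) (M : frame) (nu : Var -> world M -> Prop)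
    (F : form Var) :
  forall h, cforces M nu h (unabbrev F) <-> forces M nu h F.
Proof.
  induction F; intros h; simpl; try tauto.
  - rewrite IHF; tauto.
  (* [COr] unfolds to an implication from a negation, so recovering the disjunction takes excluded
     middle. *)
  - rewrite IHF1, IHF2. destruct (classic (forces M nu h F1)); tauto.
  - rewrite IHF1, IHF2; tauto.
  - rewrite IHF1, IHF2; tauto.
  - split; intros (h1 & h2 & ? & ? & ?); exists h1, h2;
      [rewrite <- IHF1, <- IHF2 | rewrite IHF1, IHF2]; auto.
  - split; intros H h1 h2 HR HA; apply IHF2, (H h1 h2 HR), IHF1, HA.
Qed.

(** * Soundness *)

Definition rsat (M : frame) (rho : label -> world M) (r : ratom) : Prop :=
  match r with RAtom a b c => frame_rel M (rho a) (rho b) (rho c) end.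

Definition fsat (Var : Type) (M : frame) (nu : Var -> world M -> Prop)
    (rho : label -> world M) (f : lform Var) : Prop :=
  cforces M nu (rho (fst f)) (snd f).

Definition update (M : frame) (rho : label -> world M) (x : lvar) (h : world M)
    (l : label) : world M :=
  match l with
  | LVar v => if Nat.eqb v x then h else rho (LVar v)
  | LEps => rho LEps
  end.

Lemma update_same (M : frame) (rho : label -> world M) x h :
  update M rho x h (LVar x) = h.
Proof. simpl; now rewrite Nat.eqb_refl. Qed.

Lemma update_other (M : frame) (rho : label -> world M) x h l :
  l <> LVar x -> update M rho x h l = rho l.
Proof.
  destruct l as [v|]; simpl; auto. intros Hne.
  destruct (Nat.eqb_spec v x); congruence.
Qed.

(** The directions follow the use of a rule in the soundness proof: hypotheses of the conclusion are
    pushed to the premise under the updated valuation, and what the premise yields on the right is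
    pulled back. *)
Lemma update_fresh (Var : Type) (M : frame) (nu : Var -> world M -> Prop)
    (rho : label -> world M) x h G Γ Δ :
  fresh x G Γ Δ ->
  (Forall (rsat M rho) G -> Forall (rsat M (update M rho x h)) G) /\
  (Forall (fsat M nu rho) Γ -> Forall (fsat M nu (update M rho x h)) Γ) /\
  (Exists (fsat M nu (update M rho x h)) Δ -> Exists (fsat M nu rho) Δ).
Proof.
  intros (HG & HΓ & HΔ). split; [|split].
  - rewrite !Forall_forall. intros H [a b c] Hin.
    specialize (H _ Hin). specialize (HG _ Hin). simpl in HG.
    unfold rsat in *.
    rewrite !update_other; auto; intros ->; apply HG; auto.
  - rewrite !Forall_forall. intros H f Hin. unfold fsat.
    rewrite update_other; auto. apply H, Hin.
  - rewrite !Exists_exists. intros (f & Hin & Hf). exists f; split; auto.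
    unfold fsat in *. rewrite update_other in Hf; auto.
Qed.

Lemma eval_subst (M : frame) (rho : label -> world M) y w l :
  rho (LVar w) = rho y -> rho (subst_label y w l) = rho l.
Proof.
  intros E. destruct l as [v|]; simpl; auto.
  destruct (Nat.eqb_spec v w); subst; auto.
Qed.

Lemma sat_subst (Var : Type) (M : frame) (nu : Var -> world M -> Prop)
    (rho : label -> world M) y w G Γ Δ :
  rho (LVar w) = rho y ->
  (Forall (rsat M rho) G -> Forall (rsat M rho) (map (subst_ratom y w) G)) /\
  (Forall (fsat M nu rho) Γ ->
     Forall (fsat M nu rho) (map (subst_lform y w) Γ)) /\
  (Exists (fsat M nu rho) (map (subst_lform y w) Δ) ->
     Exists (fsat M nu rho) Δ).
Proof.
  intros E. rewrite !Forall_map, Exists_map. split; [|split].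
  - apply Forall_impl. intros [a b c]; simpl. now rewrite !eval_subst.
  - apply Forall_impl. intros f; unfold fsat; simpl. now rewrite eval_subst.
  - apply Exists_impl. intros f; unfold fsat; simpl. now rewrite eval_subst.
Qed.

Ltac inv_forall :=
  repeat match goal with
  | H : Forall _ (_ :: _) |- _ => apply Forall_cons_iff in H; destruct H
  | H : Forall _ (_ ++ _) |- _ => apply Forall_app in H; destruct H
  end.

(** Induction on the derivation for all [rho] at once, because rules with fresh labels evaluate
    their premise under an updated valuation. For an implication or a wand on the right, excluded
    middle decides whether another formula of the right side already holds. Relational atoms carry
    the label of a wand in second place, the semantics in first place; commutativity mediates. *)
Lemma soundness (Var : Type) (b : bool) G Γ Δ :
  @LSBBI_C Var b G Γ Δ ->
  forall M : frame, cancellative_frame M ->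
  forall (nu : Var -> world M -> Prop) (rho : label -> world M),
    rho LEps = frame_eps M ->
    Forall (rsat M rho) G -> Forall (fsat M nu rho) Γ ->
    Exists (fsat M nu rho) Δ.
Proof.
  intros D M (Hid & Hcomm & Hassoc & Hcanc) nu.
  assert (Heps : forall h1 h2, frame_rel M (frame_eps M) h1 h2 <-> h1 = h2)
    by (intros; rewrite (Hcomm _ h1); apply Hid).
  induction D; intros rho Hrho HG HΓ; inv_forall.
  - apply (Permutation_Exists H1). apply IHD; auto.
    + rewrite Forall_forall in *. intros r Hr. now apply HG, H.
    + eapply Permutation_Forall; [symmetry|]; eassumption.
  - now left.
  - rewrite Exists_app. specialize (IHD1 _ Hrho). specialize (IHD2 _ Hrho).
    rewrite Exists_cons in IHD1. destruct IHD1 as [Hx|]; auto.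
  - contradiction.
  - left; exact I.
  - now left.
  - apply IHD; auto. constructor; auto. simpl. unfold fsat in H; simpl in H.
    rewrite H, Hrho. now apply Hid.
  - destruct H. auto.
  - specialize (IHD1 _ Hrho HG HΓ). specialize (IHD2 _ Hrho HG HΓ).
    rewrite Exists_cons in *. destruct IHD1, IHD2; auto.
    left; split; auto.
  - specialize (IHD1 _ Hrho HG H0). rewrite Exists_cons in IHD1.
    destruct IHD1 as [HA|]; auto.
    apply IHD2; auto. constructor; auto. apply H; auto.
  - rewrite Exists_cons.
    destruct (classic (Exists (fsat M nu rho) Δ)) as [|HΔ]; auto.
    left; intros HA. specialize (IHD _ Hrho HG).
    rewrite Exists_cons in IHD. destruct IHD as [HB|]; auto.
    contradiction.
  - pose proof H2 as Hz. destruct Hz as (h1 & h2 & HR & HA & HB).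
    simpl in HR, HA, HB.
    destruct (update_fresh M nu rho h1 H0) as (U1 & U2 & U3).
    destruct (update_fresh M nu (update M rho x h1) h2 H1) as (V1 & V2 & V3).
    apply U3, V3.
    assert (HΓ' : Forall (fsat M nu (update M (update M rho x h1) y h2))
              ((z, CStar A B) :: Γ)) by (apply V2, U2; constructor; auto).
    inv_forall.
    assert (Ex : update M (update M rho x h1) y h2 (LVar x) = h1)
      by (rewrite update_other, update_same; congruence).
    assert (Ey : update M (update M rho x h1) y h2 (LVar y) = h2)
      by apply update_same.
    assert (Ez : update M (update M rho x h1) y h2 z = rho z).
    { destruct H0 as (_ & F0 & _). destruct H1 as (_ & F1 & _).
      specialize (F0 _ (or_introl eq_refl)). specialize (F1 _ (or_introl eq_refl)).
      rewrite !update_other; auto. }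
    apply IHD.
    + exact Hrho.
    + constructor; auto. unfold rsat. now rewrite Ex, Ey, Ez.
    + repeat constructor; auto; unfold fsat; simpl fst; simpl snd;
        [now rewrite Ex | now rewrite Ey].
  - rewrite Exists_cons.
    destruct (classic (Exists (fsat M nu rho) Δ)) as [|HΔ]; auto.
    left. intros h1 h2 HR HA. simpl in HR.
    destruct (update_fresh M nu rho h1 H0) as (U1 & U2 & U3).
    destruct (update_fresh M nu (update M rho x h1) h2 H1) as (V1 & V2 & V3).
    assert (Ex : update M (update M rho x h1) y h2 (LVar x) = h1)
      by (rewrite update_other, update_same; congruence).
    assert (Ey : update M (update M rho x h1) y h2 (LVar y) = h2)
      by apply update_same.
    assert (Ez : update M (update M rho x h1) y h2 z = rho z).
    { destruct H0 as (_ & _ & F0). destruct H1 as (_ & _ & F1).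
      specialize (F0 _ (or_introl eq_refl)). specialize (F1 _ (or_introl eq_refl)).
      rewrite !update_other; auto. }
    specialize (IHD (update M (update M rho x h1) y h2) Hrho).
    rewrite Exists_cons in IHD. destruct IHD as [HB|HB].
    + constructor; auto. unfold rsat. rewrite Ex, Ey, Ez. now apply Hcomm.
    + constructor; auto. unfold fsat; simpl fst; simpl snd. now rewrite Ex.
    + unfold fsat in HB; simpl fst in HB; simpl snd in HB. now rewrite Ey in HB.
    + assert (HΔ' : Exists (fsat M nu rho) ((z, CWand A B) :: Δ))
        by (apply U3, V3; now right).
      rewrite Exists_cons in HΔ'. destruct HΔ' as [HW|]; [|contradiction].
      apply (HW h1 h2); auto.
  - specialize (IHD1 _ Hrho). specialize (IHD2 _ Hrho).
    rewrite !Exists_cons in *.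
    destruct IHD1 as [HA|]; auto. destruct IHD2 as [HB|]; auto.
    left. exists (rho x), (rho y). auto.
  - specialize (IHD1 _ Hrho). rewrite Exists_cons in IHD1.
    destruct IHD1 as [HA|]; auto.
    apply IHD2; auto. repeat constructor; auto.
    unfold fsat in H; simpl in H. apply (H (rho x)); auto. now apply Hcomm.
  - apply IHD; auto. repeat constructor; auto. now apply Hcomm.
  (* With both atoms commuted, [y(vu) = z] is rebracketed as [(yv)u = z]; the product [h] of [y] and
     [v] becomes the value of the fresh [w]. *)
  - destruct (@Hassoc (rho y) (rho v) (rho u) (rho z) (rho x)) as (h & Hh1 & Hh2).
    { split; now apply Hcomm. }
    destruct (update_fresh M nu rho h H) as (U1 & U2 & U3).
    assert (HG' : Forall (rsat M (update M rho w h))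
              (⟨x, y ▷ z⟩ :: ⟨u, v ▷ x⟩ :: G)) by (apply U1; auto).
    assert (Hne : forall l, in_ratom l ⟨x, y ▷ z⟩ \/ in_ratom l ⟨u, v ▷ x⟩ ->
              update M rho w h l = rho l).
    { intros l Hl. apply update_other. intros ->. destruct H as (F & _).
      destruct Hl as [Hl|Hl]; revert Hl; apply F; simpl; auto. }
    inv_forall.
    apply U3, IHD; auto.
    repeat apply Forall_cons; auto; unfold rsat;
      rewrite update_same, !Hne by (simpl; auto); auto. now apply Hcomm.
  - apply IHD; auto. constructor; auto. simpl. rewrite Hrho. now apply Hid.
  (* This is the previous case with [u = x], [v = y] and [z = x]: the single atom plays both
     roles. *)
  - destruct (@Hassoc (rho y) (rho y) (rho x) (rho x) (rho x)) as (h & Hh1 & Hh2).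
    { split; now apply Hcomm. }
    destruct (update_fresh M nu rho h H) as (U1 & U2 & U3).
    assert (Hne : forall l, in_ratom l ⟨x, y ▷ x⟩ -> update M rho w h l = rho l).
    { intros l Hl. apply update_other. intros ->. destruct H as (F & _).
      revert Hl; apply F; simpl; auto. }
    assert (HG' : Forall (rsat M (update M rho w h)) (⟨x, y ▷ x⟩ :: G))
      by (apply U1; auto).
    inv_forall.
    apply U3, IHD; auto.
    repeat apply Forall_cons; auto; unfold rsat;
      rewrite update_same, !Hne by (simpl; auto); auto. now apply Hcomm.
  - simpl in H. rewrite Hrho in H. apply Heps in H.
    destruct (sat_subst M nu rho w' w G Γ Δ) as (U1 & U2 & U3); auto.
    apply U3, IHD; auto. constructor; auto. simpl. rewrite Hrho. now apply Heps.
  - simpl in H. rewrite Hrho in H. apply Heps in H.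
    destruct (sat_subst M nu rho w' w G Γ Δ) as (U1 & U2 & U3); auto.
    apply U3, IHD; auto. constructor; auto. simpl. rewrite Hrho. now apply Heps.
  - destruct (sat_subst M nu rho y w G Γ Δ) as (U1 & U2 & U3); auto.
    symmetry. simpl in H, H0. eapply Hcanc; eauto.
Qed.

(** * Extensions of underivable sequents *)

Record sequent (Var : Type) : Type := Seq {
  atoms : list ratom;
  left : list (lform Var);
  right : list (lform Var)
}.

Definition underivable (Var : Type) (S : sequent Var) : Prop :=
  ~ LSBBI_C false (atoms S) (left S) (right S).

Definition side (Var : Type) (b : bool) (S : sequent Var) : list (lform Var) :=
  if b then left S else right S.

(** Describes what the rule for [A] leaves behind in a premise, with a disjunction where the rule
    branches. It is [False] where the rule is an axiom, where there is no rule, and for a star on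
    the right or a wand on the left, whose rules keep the principal formula. The local [real]
    inlines [realized], so that the recursion stays structural. *)
Fixpoint decomposed (Var : Type) (S : sequent Var) (A : cform Var) (b : bool)
    (w : label) {struct A} : Prop :=
  let real := fun A b w => In (w, A) (side b S) \/ decomposed S A b w in
  match A with
  | CAtom _ => False
  | CTop => False
  | CBot => False
  | CAnd B C =>
      if b then real B true w /\ real C true w
      else real B false w \/ real C false w
  | CImp B C =>
      if b then real B false w \/ real C true w
      else real B true w /\ real C false w
  | CEmp => if b then In ⟨LEps, w ▷ LEps⟩ (atoms S) else False
  | CStar B C =>
      if b then exists x y, In ⟨x, y ▷ w⟩ (atoms S) /\ real B true x /\ real C true y
      else False
  | CWand B C =>
      if b then False
      else exists x y, In ⟨x, w ▷ y⟩ (atoms S) /\ real B true x /\ real C false y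
  end.

(* [realized S A b w] says that [w : A] is present in [S] on the left
   ([b = true]) or on the right ([b = false]), or that the rule for [A] has been
   applied to it, hereditarily.  Unlike membership, this survives the rules that
   consume their principal formula. *)
Definition realized (Var : Type) (S : sequent Var) (A : cform Var) (b : bool)
    (w : label) : Prop :=
  In (w, A) (side b S) \/ decomposed S A b w.

Definition extends (Var : Type) (S : sequent Var) (th : label -> label)
    (S' : sequent Var) : Prop :=
  th LEps = LEps /\
  (forall a b c, In ⟨a, b ▷ c⟩ (atoms S) ->
     In ⟨th a, th b ▷ th c⟩ (atoms S')) /\
  (forall A b w, realized S A b w -> realized S' A b (th w)).

Lemma extends_refl (Var : Type) (S : sequent Var) : extends S (fun a => a) S.
Proof. repeat split; auto. Qed.

Lemma extends_trans (Var : Type) (S1 S2 S3 : sequent Var) th th' :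
  extends S1 th S2 -> extends S2 th' S3 ->
  extends S1 (fun a => th' (th a)) S3.
Proof.
  intros (E1 & G1 & R1) (E2 & G2 & R2). repeat split; auto.
  now rewrite E1.
Qed.

Lemma decomposed_extends (Var : Type) (S S' : sequent Var) th A b w :
  extends S th S' -> decomposed S A b w -> decomposed S' A b (th w).
Proof.
  intros (E & G & R). unfold realized in R.
  destruct A, b; cbn [decomposed]; try tauto; try (intros []; now auto).
  - intros H. apply G in H. now rewrite E in H.
  - intros (x & y & ? & ? & ?). exists (th x), (th y). auto.
  - intros (x & y & ? & ? & ?). exists (th x), (th y). auto.
Qed.

(** For a single proof step it is enough to follow atoms and formulae that are literally present:
    [decomposed] refers only to atoms and to realized immediate subformulae, so its preservation
    follows by induction on the formula. *)
Lemma extends_intro (Var : Type) (S S' : sequent Var) th :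
  th LEps = LEps ->
  (forall a b c, In ⟨a, b ▷ c⟩ (atoms S) ->
     In ⟨th a, th b ▷ th c⟩ (atoms S')) ->
  (forall A b w, In (w, A) (side b S) -> realized S' A b (th w)) ->
  extends S th S'.
Proof.
  intros E G R. repeat split; auto.
  assert (K : forall A, (forall b w, decomposed S A b w -> realized S' A b (th w)) ->
                forall b w, realized S A b w -> realized S' A b (th w))
    by (intros A HA b w []; auto).
  assert (D : forall A b w, decomposed S A b w -> decomposed S' A b (th w)).
  { induction A; intros s w; destruct s; cbn [decomposed]; try tauto;
      unfold realized in K, R; try (intros []; now auto).
    - intros H. apply G in H. now rewrite E in H.
    - intros (x & y & ? & ? & ?). exists (th x), (th y). auto 6.
    - intros (x & y & ? & ? & ?). exists (th x), (th y). auto 6. }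
  intros A. apply K. intros b w H. right. auto.
Qed.

Definition same_atoms (G G' : list ratom) : Prop := forall r, In r G <-> In r G'.

Lemma same_atoms_cons r G : In r G -> same_atoms (r :: G) G.
Proof. intros H r'; simpl; split; [intros [<-|]|]; auto. Qed.

Lemma in_permutation (T : Type) (x : T) l :
  In x l -> exists l', Permutation (x :: l') l.
Proof.
  intros H. apply in_split in H. destruct H as (l1 & l2 & ->).
  exists (l1 ++ l2). apply Permutation_middle.
Qed.

Lemma realized_in (Var : Type) (S : sequent Var) A b w :
  In (w, A) (side b S) -> realized S A b w.
Proof. now left. Qed.

(** Serves the rules that consume their principal formula [f]: [f] survives as decomposed, and
    everything else survives by membership. *)
Lemma extends_principal (Var : Type) (S S' : sequent Var) (s : bool) f l :
  (forall r, In r (atoms S) -> In r (atoms S')) ->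
  Permutation (f :: l) (side s S) ->
  (forall g, In g l -> In g (side s S')) ->
  (forall g, In g (side (negb s) S) -> In g (side (negb s) S')) ->
  decomposed S' (snd f) s (fst f) ->
  extends S (fun a => a) S'.
Proof.
  intros HG HP Hl Ho Hd. apply extends_intro; auto.
  intros A b w H.
  destruct (Bool.bool_dec b s) as [->|Hne].
  - rewrite <- HP in H. destruct H as [->|H]; [right|left]; auto.
  - left. replace b with (negb s) in * by (destruct b, s; simpl; congruence).
    auto.
Qed.

Lemma extends_weaken (Var : Type) (S S' : sequent Var) :
  incl (atoms S) (atoms S') -> incl (left S) (left S') ->
  incl (right S) (right S') -> extends S (fun a => a) S'.
Proof.
  intros HG HL HR. apply extends_intro; auto.
  intros A [] w H; apply realized_in; simpl in *; auto.
Qed.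

Lemma extends_subst (Var : Type) (S S' : sequent Var) y w :
  incl (map (subst_ratom y w) (atoms S)) (atoms S') ->
  incl (map (subst_lform y w) (left S)) (left S') ->
  incl (map (subst_lform y w) (right S)) (right S') ->
  extends S (subst_label y w) S'.
Proof.
  intros HG HL HR. apply extends_intro; auto.
  - intros a b c H. apply (in_map (subst_ratom y w)), HG in H. exact H.
  - intros A [] v H; apply realized_in; simpl in *;
      [apply (in_map (subst_lform y w)), HL in H
      |apply (in_map (subst_lform y w)), HR in H]; exact H.
Qed.

Definition label_bound (l : label) : nat :=
  match l with LVar v => S v | LEps => 0 end.

Lemma fresh_exists (Var : Type) G (Γ Δ : list (lform Var)) :
  exists x y : lvar, x <> y /\ fresh x G Γ Δ /\ fresh y G Γ Δ.
Proof.
  assert (Hl : forall ls : list label, exists n, forall v, n <= v -> ~ In (LVar v) ls).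
  { induction ls as [|l ls (n & IH)].
    - exists 0; auto.
    - exists (Nat.max (label_bound l) n). intros v Hv [->|H].
      + cbn [label_bound] in Hv. lia.
      + apply (IH v); auto. lia. }
  destruct (Hl (flat_map (fun r => match r with RAtom a b c => [a; b; c] end) G
                ++ map fst Γ ++ map fst Δ)) as (n & Hn).
  assert (Hf : forall v, n <= v -> fresh v G Γ Δ).
  { intros v Hv. specialize (Hn v Hv). rewrite !in_app_iff in Hn.
    repeat split.
    - intros [a b c] Hr Hin. apply Hn. left. apply in_flat_map.
      exists ⟨a, b ▷ c⟩. split; auto. simpl in *. intuition.
    - intros f Hr E. apply Hn. right; left. rewrite <- E. now apply in_map.
    - intros f Hr E. apply Hn. right; right. rewrite <- E. now apply in_map. }
  exists n, (S n). auto.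
Qed.

(** * Goals achievable by underivable extensions *)

Lemma repr_iff (Var : Type) b G G' (Γ Γ' Δ Δ' : list (lform Var)) :
  same_atoms G G' -> Permutation Γ Γ' -> Permutation Δ Δ' ->
  LSBBI_C b G Γ Δ <-> LSBBI_C b G' Γ' Δ'.
Proof.
  intros HG HΓ HΔ. split; apply r_repr; auto; now symmetry.
Qed.

(* The first conjunct, stability under further extension, is what lets finitely
   many goals be enforced one after another. *)
Definition achievable (Var : Type) (S : sequent Var)
    (Q : (label -> label) -> sequent Var -> Prop) : Prop :=
  (forall th S1 th' S2,
     extends S1 th' S2 -> Q th S1 -> Q (fun a => th' (th a)) S2) /\
  (forall th S1, extends S th S1 -> underivable S1 ->
     exists th' S2, underivable S2 /\ extends S1 th' S2 /\
       Q (fun a => th' (th a)) S2).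

Lemma achievable_true (Var : Type) (S : sequent Var) :
  achievable S (fun _ _ => True).
Proof.
  split; auto. intros th S1 _ H. exists (fun a => a), S1.
  auto using extends_refl.
Qed.

Lemma achievable_and (Var : Type) (S : sequent Var) Q1 Q2 :
  achievable S Q1 -> achievable S Q2 ->
  achievable S (fun th S' => Q1 th S' /\ Q2 th S').
Proof.
  intros (St1 & A1) (St2 & A2). split.
  - intros th S1 th' S2 E (H1 & H2). eauto.
  - intros th S1 E U.
    destruct (A1 th S1 E U) as (th1 & S2 & U2 & E2 & H1).
    destruct (A2 _ S2 (extends_trans E E2) U2) as (th2 & S3 & U3 & E3 & H2).
    exists (fun a => th2 (th1 a)), S3. split; [|split; [|split]]; auto.
    + eapply extends_trans; eauto.
    + exact (St1 _ _ _ _ E3 H1).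
Qed.

Lemma achievable_impl (Var : Type) (S : sequent Var) (P : Prop) Q :
  (P -> achievable S Q) -> achievable S (fun th S' => P -> Q th S').
Proof.
  intros H. destruct (classic P) as [p|np].
  - destruct (H p) as (St & A). split.
    + intros; eauto.
    + intros th S1 E U. destruct (A th S1 E U) as (th1 & S2 & ? & ? & ?). eauto 6.
  - split; [tauto|]. intros th S1 _ U. exists (fun a => a), S1.
    repeat split; auto; tauto.
Qed.

Lemma achievable_forall (Var T : Type) (S : sequent Var) (l : list T)
    (Q : T -> (label -> label) -> sequent Var -> Prop) :
  (forall x, In x l -> achievable S (Q x)) ->
  achievable S (fun th S' => forall x, In x l -> Q x th S').
Proof.
  induction l as [|x l IH]; intros H.
  - split; [simpl; tauto|]. intros th S1 _ U. exists (fun a => a), S1.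
    repeat split; auto; simpl; tauto.
  - destruct (achievable_and (H x (or_introl eq_refl))
                (IH (fun y Hy => H y (or_intror Hy)))) as (St & A).
    split.
    + intros th S1 th' S2 E HQ y Hy.
      destruct (St th S1 th' S2 E) as (Hx & Hl).
      { split; [|intros z Hz]; apply HQ; simpl; auto. }
      destruct Hy as [<-|Hy]; auto.
    + intros th S1 E U. destruct (A th S1 E U) as (th1 & S2 & U2 & E2 & Hx & Hl).
      exists th1, S2. repeat split; auto; try apply E2.
      intros y [<-|Hy]; auto.
Qed.

Lemma achievable_atom (Var : Type) (S : sequent Var) a b c :
  (forall S1 th, extends S th S1 -> underivable S1 ->
     underivable (Seq (⟨th a, th b ▷ th c⟩ :: atoms S1) (left S1) (right S1))) ->
  achievable S (fun th S' => In ⟨th a, th b ▷ th c⟩ (atoms S')).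
Proof.
  intros H. split.
  - intros th S1 th' S2 (_ & G & _) HQ. now apply G in HQ.
  - intros th S1 E U. eexists (fun a => a), _. split; [exact (H _ _ E U)|].
    split; [|simpl; auto]. apply extends_weaken; simpl; auto using incl_refl, incl_tl.
Qed.

Lemma achievable_E (Var : Type) (S : sequent Var) x y z :
  In ⟨x, y ▷ z⟩ (atoms S) ->
  achievable S (fun th S' => In ⟨th y, th x ▷ th z⟩ (atoms S')).
Proof.
  intros H. apply achievable_atom. intros S1 th (_ & G & _) U D. apply U.
  apply G in H. simpl in D.
  apply (repr_iff false (same_atoms_cons _ _ H) (Permutation_refl _) (Permutation_refl _)).
  apply r_E. eapply repr_iff; [| | |exact D]; auto.
  intros r; simpl; split; [|tauto]. intros [|[<-|]]; auto.
Qed.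

Lemma achievable_U (Var : Type) (S : sequent Var) x :
  achievable S (fun th S' => In ⟨th x, LEps ▷ th x⟩ (atoms S')).
Proof.
  destruct (achievable_atom (S := S) (a := x) (b := LEps) (c := x))
    as (St & A).
  - intros S1 th (E & _ & _) U D. apply U. simpl in D. rewrite E in D.
    now apply r_U in D.
  - split.
    + intros th S1 th' S2 (E & G & _) HQ. apply G in HQ. now rewrite E in HQ.
    + intros th S1 E U. destruct (A th S1 E U) as (th' & S2 & U2 & E2 & HQ).
      exists th', S2. split; [|split]; auto.
      destruct E as (E & _), E2 as (E2 & _). now rewrite E, E2 in HQ.
Qed.

Lemma achievable_A (Var : Type) (S : sequent Var) x y z u v :
  In ⟨x, y ▷ z⟩ (atoms S) -> In ⟨u, v ▷ x⟩ (atoms S) ->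
  achievable S (fun th S' => exists w,
    In ⟨th u, w ▷ th z⟩ (atoms S') /\ In ⟨th y, th v ▷ w⟩ (atoms S')).
Proof.
  intros H1 H2. split.
  - intros th S1 th' S2 (_ & G & _) (w & HQ1 & HQ2). exists (th' w).
    split; now apply G.
  - intros th S1 (_ & G & _) U. apply G in H1, H2.
    destruct (fresh_exists (atoms S1) (left S1) (right S1)) as (w & _ & _ & F & _).
    exists (fun a => a),
      (Seq (⟨th u, LVar w ▷ th z⟩ :: ⟨th y, th v ▷ LVar w⟩ :: atoms S1)
        (left S1) (right S1)).
    split; [|split].
    + intros D. apply U. simpl in D.
      (* Atoms form a set, so both principal atoms may be put in front of the full list without
         removing them from it; this also covers the case where they coincide. *)
      assert (Hs : same_atoms (⟨th x, th y ▷ th z⟩ :: ⟨th u, th v ▷ th x⟩ :: atoms S1)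
                     (atoms S1)).
      { intros r; simpl; split; [|tauto]. intros [<-|[<-|]]; auto. }
      apply (repr_iff false Hs (Permutation_refl _) (Permutation_refl _)).
      apply r_A with (w := w).
      * destruct F as (F1 & F2 & F3). repeat split; auto.
        intros r Hr. apply F1. now apply Hs.
      * eapply repr_iff; [| | |exact D]; auto.
        intros r; simpl; split; [|tauto]. intros [|[|[<-|[<-|]]]]; auto.
    + apply extends_weaken; simpl; auto using incl_refl, incl_tl.
    + exists (LVar w); simpl; auto.
Qed.

(** The common core of Eq and C. Two labels that still differ cannot both be [LEps], so one of them
    is a variable [LVar w], and replacing it by the other label [y] merges them. The hypothesis
    provides an underivable premise of the merging rule. *)
Lemma achievable_eq (Var : Type) (S : sequent Var) a b :
  (forall S1 th y w, extends S th S1 -> underivable S1 ->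
     (th a = y /\ th b = LVar w \/ th a = LVar w /\ th b = y) ->
     exists G', incl (map (subst_ratom y w) (atoms S1)) G' /\
       ~ LSBBI_C false G' (map (subst_lform y w) (left S1))
           (map (subst_lform y w) (right S1))) ->
  achievable S (fun th _ => th a = th b).
Proof.
  intros H. split; [congruence|].
  intros th S1 E U.
  assert (K : th a = th b \/ exists y w, y <> LVar w /\
    (th a = y /\ th b = LVar w \/ th a = LVar w /\ th b = y)).
  { destruct (th a) as [v1|] eqn:Ea, (th b) as [v2|] eqn:Eb; auto.
    - destruct (Nat.eq_dec v1 v2); [left; congruence|].
      right. exists (LVar v1), v2. split; auto. congruence.
    - right. exists LEps, v1. split; auto. congruence.
    - right. exists LEps, v2. split; auto. congruence. }
  destruct K as [K|(y & w & Hne & K)].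
  - exists (fun a => a), S1. auto using extends_refl.
  - destruct (H S1 th y w E U K) as (G' & HG & U').
    exists (subst_label y w), (Seq G' (map (subst_lform y w) (left S1))
           (map (subst_lform y w) (right S1))).
    split; [exact U'|]. split; [apply extends_subst; auto using incl_refl|].
    assert (Ew : subst_label y w (LVar w) = y) by (simpl; now rewrite Nat.eqb_refl).
    assert (Ey : subst_label y w y = y).
    { destruct y as [v|]; simpl; auto. destruct (Nat.eqb_spec v w); congruence. }
    destruct K as [[-> ->]|[-> ->]]; congruence.
Qed.

(** The context of the rule is taken to be the whole of [atoms S1], principal atom included, so the
    premise contains the image of every atom. The position of the variable being replaced decides
    between Eq_1 and Eq_2. *)
Lemma achievable_Eq (Var : Type) (S : sequent Var) a b :
  In ⟨LEps, a ▷ b⟩ (atoms S) -> achievable S (fun th _ => th a = th b).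
Proof.
  intros H. apply achievable_eq. intros S1 th y w (E & G & _) U K.
  apply G in H. rewrite E in H.
  exists (⟨LEps, y ▷ y⟩ :: map (subst_ratom y w) (atoms S1)).
  split; [auto using incl_refl, incl_tl|]. intros D. apply U.
  apply (repr_iff false (same_atoms_cons _ _ H) (Permutation_refl _) (Permutation_refl _)).
  destruct K as [[-> ->]|[-> ->]]; [now apply r_Eq2|now apply r_Eq1].
Qed.

Lemma achievable_C (Var : Type) (S : sequent Var) x a b z :
  In ⟨x, a ▷ z⟩ (atoms S) -> In ⟨x, b ▷ z⟩ (atoms S) ->
  achievable S (fun th _ => th a = th b).
Proof.
  intros H1 H2. apply achievable_eq. intros S1 th y w (E & G & _) U K.
  apply G in H1, H2.
  exists (⟨th x, y ▷ th z⟩ :: map (subst_ratom y w) (atoms S1)).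
  split; [auto using incl_refl, incl_tl|]. intros D. apply U.
  assert (Hs : same_atoms (⟨th x, y ▷ th z⟩ :: ⟨th x, LVar w ▷ th z⟩ :: atoms S1)
                 (atoms S1)).
  { intros r; simpl; split; [|tauto].
    destruct K as [[<- <-]|[<- <-]]; intros [<-|[<-|]]; auto. }
  apply (repr_iff false Hs (Permutation_refl _) (Permutation_refl _)).
  now apply r_C.
Qed.

Lemma realized_star_right (Var : Type) (S : sequent Var) A B w :
  realized S (CStar A B) false w -> In (w, CStar A B) (right S).
Proof. intros [|[]]; auto. Qed.

Lemma realized_wand_left (Var : Type) (S : sequent Var) A B w :
  realized S (CWand A B) true w -> In (w, CWand A B) (left S).
Proof. intros [|[]]; auto. Qed.

(** The rule keeps its principal formula, so each premise merely adds a formula to the sequent; were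
    both derivable, so would be the sequent. The goal asks for [realized] because the added formula
    may be consumed by a later step. *)
Lemma achievable_starR (Var : Type) (S : sequent Var) x y z A B :
  In ⟨x, y ▷ z⟩ (atoms S) -> In (z, CStar A B) (right S) ->
  achievable S (fun th S' =>
    realized S' A false (th x) \/ realized S' B false (th y)).
Proof.
  intros H1 H2. split.
  - intros th S1 th' S2 (_ & _ & R) [HQ|HQ]; apply R in HQ; auto.
  - intros th S1 (_ & G & R) U. apply G in H1.
    apply (realized_in S _ false), R, realized_star_right in H2.
    destruct (in_permutation _ _ H2) as (l & HP).
    destruct (classic (LSBBI_C false (atoms S1) (left S1) ((th x, A) :: right S1)))
      as [D1|U1];
    [destruct (classic (LSBBI_C false (atoms S1) (left S1) ((th y, B) :: right S1)))
      as [D2|U1]|].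
    + destruct U.
      apply (repr_iff false (same_atoms_cons _ _ H1) (Permutation_refl _) HP).
      apply r_starR;
        [eapply repr_iff; [| | |exact D1]|eapply repr_iff; [| | |exact D2]];
        auto; try now apply same_atoms_cons.
    + exists (fun a => a), (Seq (atoms S1) (left S1) ((th y, B) :: right S1)).
      split; [exact U1|]. split.
      * apply extends_weaken; simpl; auto using incl_refl, incl_tl.
      * right. apply realized_in; simpl; auto.
    + exists (fun a => a), (Seq (atoms S1) (left S1) ((th x, A) :: right S1)).
      split; [exact U1|]. split.
      * apply extends_weaken; simpl; auto using incl_refl, incl_tl.
      * left. apply realized_in; simpl; auto.
Qed.

Lemma achievable_wandL (Var : Type) (S : sequent Var) x y z A B :
  In ⟨x, y ▷ z⟩ (atoms S) -> In (y, CWand A B) (left S) ->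
  achievable S (fun th S' =>
    realized S' A false (th x) \/ realized S' B true (th z)).
Proof.
  intros H1 H2. split.
  - intros th S1 th' S2 (_ & _ & R) [HQ|HQ]; apply R in HQ; auto.
  - intros th S1 (_ & G & R) U. apply G in H1.
    apply (realized_in S _ true), R, realized_wand_left in H2.
    destruct (in_permutation _ _ H2) as (l & HP).
    destruct (classic (LSBBI_C false (atoms S1) (left S1) ((th x, A) :: right S1)))
      as [D1|U1];
    [destruct (classic (LSBBI_C false (atoms S1) ((th z, B) :: left S1) (right S1)))
      as [D2|U1]|].
    + destruct U.
      apply (repr_iff false (same_atoms_cons _ _ H1) HP (Permutation_refl _)).
      apply r_wandL;
        [eapply repr_iff; [| | |exact D1]|eapply repr_iff; [| | |exact D2]];
        auto; try now apply same_atoms_cons.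
      rewrite perm_swap. auto.
    + exists (fun a => a), (Seq (atoms S1) ((th z, B) :: left S1) (right S1)).
      split; [exact U1|]. split.
      * apply extends_weaken; simpl; auto using incl_refl, incl_tl.
      * right. apply realized_in; simpl; auto.
    + exists (fun a => a), (Seq (atoms S1) (left S1) ((th x, A) :: right S1)).
      split; [exact U1|]. split.
      * apply extends_weaken; simpl; auto using incl_refl, incl_tl.
      * left. apply realized_in; simpl; auto.
Qed.

(** * Decomposition by the logical rules *)

(** Marks the occurrences that no logical rule removes, which can therefore be tracked by
    membership. [CTop] on the right and [CBot] on the left do not count as persistent: they make the
    sequent an axiom, and their [decomposed], being [False], expresses this contradiction. *)
Definition persistent (Var : Type) (b : bool) (A : cform Var) : bool :=
  match A with
  | CAtom _ => true
  | CTop => b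
  | CBot => negb b
  | CEmp | CStar _ _ => negb b
  | CWand _ _ => b
  | _ => false
  end.

(** Every rule is read contrapositively: an underivable conclusion has an underivable premise.
    Logical rules merge no labels, so the label map is the identity. For [CTop] on the right and
    [CBot] on the left, the sequent is an axiom and contradicts [U]. *)
Lemma decompose (Var : Type) (S : sequent Var) A b w :
  underivable S -> persistent b A = false -> In (w, A) (side b S) ->
  exists S', underivable S' /\ extends S (fun a => a) S' /\ decomposed S' A b w.
Proof.
  intros U HA Hin.
  destruct (in_permutation _ _ Hin) as (l & HP).
  assert (Step : forall S',
      incl (atoms S) (atoms S') -> incl l (side b S') ->
      incl (side (negb b) S) (side (negb b) S') -> decomposed S' A b w ->
      underivable S' ->
      exists S', underivable S' /\ extends S (fun a => a) S' /\ decomposed S' A b w).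
  { intros S' HG Hl Ho Hd U'. exists S'. split; [|split]; auto.
    eapply extends_principal with (s := b) (l := l); eauto. }
  destruct A as [p| | |A B|A B| |A B|A B], b; try discriminate HA; simpl in HP.
  - destruct U. apply (repr_iff false (fun r => iff_refl _) (Permutation_refl _) HP).
    apply r_topR.
  - destruct U. apply (repr_iff false (fun r => iff_refl _) HP (Permutation_refl _)).
    apply r_botL.
  - apply (Step (Seq (atoms S) ((w, A) :: (w, B) :: l) (right S)));
      simpl; auto 7 using incl_refl, incl_tl.
    intros D. apply U.
      apply (repr_iff false (fun r => iff_refl _) HP (Permutation_refl _)).
      now apply r_andL.
  - destruct (classic (LSBBI_C false (atoms S) (left S) ((w, A) :: l))) as [D1|U1];
    [destruct (classic (LSBBI_C false (atoms S) (left S) ((w, B) :: l))) as [D2|U1]|].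
    + destruct U. apply (repr_iff false (fun r => iff_refl _) (Permutation_refl _) HP).
      now apply r_andR.
    + apply (Step (Seq (atoms S) (left S) ((w, B) :: l)));
        simpl; auto 7 using incl_refl, incl_tl.
    + apply (Step (Seq (atoms S) (left S) ((w, A) :: l)));
        simpl; auto 7 using incl_refl, incl_tl.
  - destruct (classic (LSBBI_C false (atoms S) l ((w, A) :: right S))) as [D1|U1];
    [destruct (classic (LSBBI_C false (atoms S) ((w, B) :: l) (right S))) as [D2|U1]|].
    + destruct U. apply (repr_iff false (fun r => iff_refl _) HP (Permutation_refl _)).
      now apply r_impL.
    + apply (Step (Seq (atoms S) ((w, B) :: l) (right S)));
        simpl; auto 7 using incl_refl, incl_tl.
    + apply (Step (Seq (atoms S) l ((w, A) :: right S)));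
        simpl; auto 7 using incl_refl, incl_tl.
  - apply (Step (Seq (atoms S) ((w, A) :: left S) ((w, B) :: l)));
      simpl; auto 7 using incl_refl, incl_tl.
    intros D. apply U.
      apply (repr_iff false (fun r => iff_refl _) (Permutation_refl _) HP).
      now apply r_impR.
  - apply (Step (Seq (⟨LEps, w ▷ LEps⟩ :: atoms S) l (right S)));
      simpl; auto 7 using incl_refl, incl_tl.
    intros D. apply U.
    apply (repr_iff false (fun r => iff_refl _) HP (Permutation_refl _)).
    now apply r_empL.
  - destruct (fresh_exists (atoms S) ((w, CStar A B) :: l) (right S))
      as (x & y & Hxy & Fx & Fy).
    apply (Step (Seq (⟨LVar x, LVar y ▷ w⟩ :: atoms S)
                   ((LVar x, A) :: (LVar y, B) :: l) (right S)));
      simpl; auto 7 using incl_refl, incl_tl.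
    + exists (LVar x), (LVar y). auto 10.
    + intros D. apply U.
      apply (repr_iff false (fun r => iff_refl _) HP (Permutation_refl _)).
      now apply r_starL with (x := x) (y := y).
  - destruct (fresh_exists (atoms S) (left S) ((w, CWand A B) :: l))
      as (x & y & Hxy & Fx & Fy).
    apply (Step (Seq (⟨LVar x, w ▷ LVar y⟩ :: atoms S)
                   ((LVar x, A) :: left S) ((LVar y, B) :: l)));
      simpl; auto 7 using incl_refl, incl_tl.
    + exists (LVar x), (LVar y). auto 10.
    + intros D. apply U.
      apply (repr_iff false (fun r => iff_refl _) (Permutation_refl _) HP).
      now apply r_wandR with (x := x) (y := y).
Qed.

Lemma achievable_decomposed (Var : Type) (S : sequent Var) A b w :
  persistent b A = false -> In (w, A) (side b S) ->
  achievable S (fun th S' => decomposed S' A b (th w)).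
Proof.
  intros HA Hin. split.
  - intros th S1 th' S2 E HQ. exact (decomposed_extends A b (th w) E HQ).
  - intros th S1 (_ & _ & R) U. apply realized_in, R in Hin.
    destruct Hin as [Hin|Hd].
    + destruct (decompose _ _ _ U HA Hin) as (S2 & U2 & E2 & HD).
      exists (fun a => a), S2. auto.
    + exists (fun a => a), S1. auto using extends_refl.
Qed.

(** * Saturation *)

Unset Strict Implicit.

(** One round of proof search: the rule instances offered by [S] have been treated on reaching [S'],
    while those that arise in between wait for the next round. Requiring U only for labels that
    occur in atoms keeps a round finite. *)
Record saturates (Var : Type) (S : sequent Var) (th : label -> label)
    (S' : sequent Var) : Prop := {
  sat_E : forall x y z, In ⟨x, y ▷ z⟩ (atoms S) ->
    In ⟨th y, th x ▷ th z⟩ (atoms S');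
  sat_U : forall x y z, In ⟨x, y ▷ z⟩ (atoms S) ->
    In ⟨th x, LEps ▷ th x⟩ (atoms S') /\ In ⟨th y, LEps ▷ th y⟩ (atoms S') /\
    In ⟨th z, LEps ▷ th z⟩ (atoms S');
  sat_A : forall x y z u v, In ⟨x, y ▷ z⟩ (atoms S) -> In ⟨u, v ▷ x⟩ (atoms S) ->
    exists w, In ⟨th u, w ▷ th z⟩ (atoms S') /\ In ⟨th y, th v ▷ w⟩ (atoms S');
  sat_Eq : forall a b, In ⟨LEps, a ▷ b⟩ (atoms S) -> th a = th b;
  sat_C : forall x a b z, In ⟨x, a ▷ z⟩ (atoms S) -> In ⟨x, b ▷ z⟩ (atoms S) ->
    th a = th b;
  sat_starR : forall x y z A B,
    In ⟨x, y ▷ z⟩ (atoms S) -> In (z, CStar A B) (right S) ->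
    realized S' A false (th x) \/ realized S' B false (th y);
  sat_wandL : forall x y z A B,
    In ⟨x, y ▷ z⟩ (atoms S) -> In (y, CWand A B) (left S) ->
    realized S' A false (th x) \/ realized S' B true (th z);
  sat_decomposed : forall A b w,
    persistent b A = false -> In (w, A) (side b S) -> decomposed S' A b (th w)
}.

Lemma saturating_extension (Var : Type) (S : sequent Var) :
  underivable S ->
  exists th S', underivable S' /\ extends S th S' /\ saturates S th S'.
Proof.
  intros U.
  (* The fields of [saturates] are rephrased as quantifications over the finite lists of [S], so
     that together they form a finite conjunction of achievable goals. *)
  assert (Ach : achievable S (fun th S' =>
    (forall r, In r (atoms S) -> match r with ⟨x, y ▷ z⟩ =>
       In ⟨th y, th x ▷ th z⟩ (atoms S') /\
       (In ⟨th x, LEps ▷ th x⟩ (atoms S') /\ In ⟨th y, LEps ▷ th y⟩ (atoms S') /\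
        In ⟨th z, LEps ▷ th z⟩ (atoms S')) /\
       (x = LEps -> th y = th z) /\
       (forall f, In f (right S) -> match f with
        | (w, CStar A B) => w = z ->
            realized S' A false (th x) \/ realized S' B false (th y)
        | _ => True end) /\
       (forall f, In f (left S) -> match f with
        | (w, CWand A B) => w = y ->
            realized S' A false (th x) \/ realized S' B true (th z)
        | _ => True end) /\
       (forall r', In r' (atoms S) -> match r' with ⟨u, v ▷ t⟩ =>
         (t = x -> exists w, In ⟨th u, w ▷ th z⟩ (atoms S') /\
                             In ⟨th y, th v ▷ w⟩ (atoms S')) /\
         (u = x /\ t = z -> th y = th v) end)
     end) /\
    (forall b, In b [true; false] -> forall f, In f (side b S) ->
       persistent b (snd f) = false -> decomposed S' (snd f) b (th (fst f))))).
  { apply achievable_and; apply achievable_forall.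
    - intros [x y z] Hr. repeat apply achievable_and.
      + now apply achievable_E.
      + apply achievable_U.
      + apply achievable_U.
      + apply achievable_U.
      + apply achievable_impl. intros ->. now apply achievable_Eq.
      + apply achievable_forall. intros [w f] Hf.
        destruct f; try apply achievable_true.
        apply achievable_impl. intros ->. eapply achievable_starR; eauto.
      + apply achievable_forall. intros [w f] Hf.
        destruct f; try apply achievable_true.
        apply achievable_impl. intros ->. eapply achievable_wandL; eauto.
      + apply achievable_forall. intros [u v t] Hr'. apply achievable_and.
        * apply achievable_impl. intros ->. eapply achievable_A; eauto.
        * apply achievable_impl. intros [-> ->]. eapply achievable_C; eauto.
    - intros b _. apply achievable_forall. intros [w A] Hf.
      apply achievable_impl. intros HA. now apply achievable_decomposed. }
  destruct (proj2 Ach _ S (extends_refl S) U) as (th & S' & U' & E & HG & HF).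
  exists th, S'. split; [|split]; auto. clear Ach. split.
  - intros x y z H. apply HG in H. tauto.
  - intros x y z H. apply HG in H. tauto.
  - intros x y z u v H1 H2. apply HG in H1. destruct H1 as (_ & _ & _ & _ & _ & H1).
    apply (H1 _ H2). auto.
  - intros a b H. apply HG in H. tauto.
  - intros x a b z H1 H2. apply HG in H1. destruct H1 as (_ & _ & _ & _ & _ & H1).
    apply (H1 _ H2). auto.
  - intros x y z A B H1 H2. apply HG in H1.
    destruct H1 as (_ & _ & _ & H1 & _). apply (H1 _ H2). auto.
  - intros x y z A B H1 H2. apply HG in H1.
    destruct H1 as (_ & _ & _ & _ & H1 & _). apply (H1 _ H2). auto.
  - intros A b w HA Hin. apply (HF b) with (f := (w, A)); auto.
    destruct b; simpl; auto.
Qed.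

(** * The countermodel *)

Record chain (Var : Type) : Type := Chain {
  stage : nat -> sequent Var;
  next : nat -> label -> label;
  stage_underivable : forall n, underivable (stage n);
  stage_extends : forall n, extends (stage n) (next n) (stage (S n));
  stage_saturates : forall n, saturates (stage n) (next n) (stage (S n))
}.

(** Dependent choice along [saturating_extension], with underivability carried in the type [X] so
    that the step can be iterated. *)
Lemma chain_exists (Var : Type) (S0 : sequent Var) :
  underivable S0 -> exists K : chain Var, stage K 0 = S0.
Proof.
  intros U0.
  pose (X := {S : sequent Var | underivable S}).
  assert (Hstep : forall s : X, exists p : (label -> label) * X,
            extends (proj1_sig s) (fst p) (proj1_sig (snd p)) /\
            saturates (proj1_sig s) (fst p) (proj1_sig (snd p))).
  { intros (S & U). destruct (saturating_extension U) as (th & S' & U' & E & Sa).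
    exists (th, exist _ S' U'). auto. }
  pose (step := fun s => proj1_sig (constructive_indefinite_description _ (Hstep s))).
  assert (step_spec : forall s,
            extends (proj1_sig s) (fst (step s)) (proj1_sig (snd (step s))) /\
            saturates (proj1_sig s) (fst (step s)) (proj1_sig (snd (step s))))
    by (intros s; apply (proj2_sig (constructive_indefinite_description _ (Hstep s)))).
  pose (st := fix st n : X := match n with
              | 0 => exist _ S0 U0
              | S n => snd (step (st n)) end).
  unshelve eexists (@Chain Var (fun n => proj1_sig (st n))
    (fun n => fst (step (st n))) _ _ _).
  - intros n. exact (proj2_sig (st n)).
  - intros n. apply (step_spec (st n)).
  - intros n. apply (step_spec (st n)).
  - reflexivity.
Qed.

(* [transport K n m] is the identity when [m <= n]. *)
Fixpoint transport (Var : Type) (K : chain Var) (n m : nat) (a : label) : label :=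
  match m with
  | 0 => a
  | S m' => if n <=? m' then next K m' (transport K n m' a) else a
  end.

Lemma transport_id (Var : Type) (K : chain Var) n m a :
  m <= n -> transport K n m a = a.
Proof.
  destruct m; simpl; auto. intros H.
  destruct (Nat.leb_spec n m); auto; lia.
Qed.

Lemma transport_S (Var : Type) (K : chain Var) n m a :
  n <= m -> transport K n (S m) a = next K m (transport K n m a).
Proof. intros H. simpl. destruct (Nat.leb_spec n m); auto; lia. Qed.

Lemma transport_trans (Var : Type) (K : chain Var) n m k a :
  n <= m -> m <= k -> transport K m k (transport K n m a) = transport K n k a.
Proof.
  intros Hnm Hmk. induction Hmk as [|k Hmk IH].
  - now apply transport_id.
  - rewrite !transport_S by lia. now rewrite IH.
Qed.

Lemma transport_extends (Var : Type) (K : chain Var) n m :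
  n <= m -> extends (stage K n) (transport K n m) (stage K m).
Proof.
  induction 1 as [|m H IH].
  - apply extends_intro.
    + now apply transport_id.
    + intros a b c. now rewrite !transport_id.
    + intros A b w. rewrite transport_id by auto. apply realized_in.
  - pose proof (extends_trans IH (stage_extends K m)) as (E & G & R).
    pose proof (fun a => transport_S K a H) as T.
    split; [|split].
    + now rewrite T.
    + intros a b c. rewrite !T. apply G.
    + intros A b w. rewrite !T. apply R.
Qed.

Lemma transport_eps (Var : Type) (K : chain Var) n m :
  n <= m -> transport K n m LEps = LEps.
Proof. intros H. apply (transport_extends K H). Qed.

Lemma transport_atom (Var : Type) (K : chain Var) n m a b c :
  n <= m -> In ⟨a, b ▷ c⟩ (atoms (stage K n)) ->
  In ⟨transport K n m a, transport K n m b ▷ transport K n m c⟩ (atoms (stage K m)).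
Proof. intros H. apply (transport_extends K H). Qed.

Lemma transport_realized (Var : Type) (K : chain Var) n m A b w :
  n <= m -> realized (stage K n) A b w ->
  realized (stage K m) A b (transport K n m w).
Proof. intros H. apply (transport_extends K H). Qed.

(** * The direct limit of the labels *)

(** The equivalence that defines the direct limit: labels of two stages are identified when their
    images agree at some common later stage. *)
Definition germ (Var : Type) (K : chain Var) (n : nat) (a : label)
    (m : nat) (b : label) : Prop :=
  exists k, n <= k /\ m <= k /\ transport K n k a = transport K m k b.

(* Worlds are the elements of the direct limit of the label maps, restricted to
   the labels [a] for which U has supplied an atom [(a, eps |> a)], as the identity
   condition requires. *)
Definition limit_world (Var : Type) (K : chain Var) : Type :=
  {P : nat -> label -> Prop |
    exists n a, In ⟨a, LEps ▷ a⟩ (atoms (stage K n)) /\ P = germ K n a}.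

Definition rep (Var : Type) (K : chain Var) (h : limit_world K) (n : nat)
    (a : label) : Prop := proj1_sig h n a.

Lemma germ_sym (Var : Type) (K : chain Var) n a m b :
  germ K n a m b -> germ K m b n a.
Proof. intros (k & ? & ? & ?). exists k. auto. Qed.

Lemma germ_trans (Var : Type) (K : chain Var) n a m b k c :
  germ K n a m b -> germ K m b k c -> germ K n a k c.
Proof.
  intros (i & Hn & Hm & E1) (j & Hm' & Hk & E2). exists (Nat.max i j).
  split; [lia|split; [lia|]].
  rewrite <- (@transport_trans _ K n i (Nat.max i j)), E1, transport_trans by lia.
  rewrite <- (@transport_trans _ K k j (Nat.max i j)), <- E2, transport_trans by lia.
  reflexivity.
Qed.

Lemma germ_transport (Var : Type) (K : chain Var) n m a :
  n <= m -> germ K n a m (transport K n m a).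
Proof.
  intros H. exists m. repeat split; auto. symmetry. now apply transport_id.
Qed.

Lemma rep_germ (Var : Type) (K : chain Var) (h : limit_world K) n a m b :
  rep h n a -> (rep h m b <-> germ K n a m b).
Proof.
  destruct h as (P & n0 & a0 & H0 & ->). unfold rep; simpl. intros H. split.
  - intros H'. eapply germ_trans; [apply germ_sym|]; eassumption.
  - intros H'. eapply germ_trans; eassumption.
Qed.

Lemma rep_exists (Var : Type) (K : chain Var) (h : limit_world K) :
  exists n a, rep h n a /\ In ⟨a, LEps ▷ a⟩ (atoms (stage K n)).
Proof.
  destruct h as (P & n & a & H & E) eqn:Eh. exists n, a. split; auto.
  unfold rep; simpl. rewrite E. exists n. auto.
Qed.

(** Equivalence classes sharing a representative coincide. Worlds encode classes as predicates, so
    extensionality turns this into an equality of worlds, proof irrelevance disposing of the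
    membership proofs. *)
Lemma rep_inj (Var : Type) (K : chain Var) (h h' : limit_world K) n a :
  rep h n a -> rep h' n a -> h = h'.
Proof.
  intros H H'.
  assert (E : proj1_sig h = proj1_sig h').
  { apply functional_extensionality; intros m.
    apply functional_extensionality; intros b.
    apply propositional_extensionality.
    etransitivity; [apply (rep_germ m b H)|].
    symmetry. apply (rep_germ m b H'). }
  destruct h as (P & p), h' as (P' & p'). simpl in E. subst P'.
  f_equal. apply proof_irrelevance.
Qed.

Lemma rep_transport (Var : Type) (K : chain Var) (h : limit_world K) n m a :
  n <= m -> rep h n a -> rep h m (transport K n m a).
Proof. intros Hnm H. apply (rep_germ _ _ H). now apply germ_transport. Qed.

Lemma rep_next (Var : Type) (K : chain Var) (h : limit_world K) n a :
  rep h n a -> rep h (S n) (next K n a).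
Proof.
  intros H. apply (rep_transport (Nat.le_succ_diag_r n)) in H.
  now rewrite transport_S, transport_id in H.
Qed.

(** Brings facts recorded at different stages to one stage where the labels of a common world are
    literally equal. *)
Lemma rep_eventually_eq (Var : Type) (K : chain Var) (h : limit_world K) n a m b :
  rep h n a -> rep h m b -> exists k0, n <= k0 /\ m <= k0 /\
    forall k, k0 <= k -> transport K n k a = transport K m k b.
Proof.
  intros H H'. apply (rep_germ _ _ H) in H'. destruct H' as (k0 & Hn & Hm & E).
  exists k0. repeat split; auto. intros k Hk.
  rewrite <- (@transport_trans _ K n k0 k), E by auto. now apply transport_trans.
Qed.

Lemma world_of_label (Var : Type) (K : chain Var) n a :
  In ⟨a, LEps ▷ a⟩ (atoms (stage K n)) -> exists h : limit_world K, rep h n a.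
Proof.
  intros H.
  exists (exist _ (germ K n a) (ex_intro _ n (ex_intro _ a (conj H eq_refl)))).
  exists n. auto.
Qed.

Lemma world_of_next (Var : Type) (K : chain Var) n a :
  In ⟨next K n a, LEps ▷ next K n a⟩ (atoms (stage K (S n))) ->
  exists h : limit_world K, rep h n a.
Proof.
  intros H. destruct (world_of_label H) as (h & Hh). exists h.
  apply (rep_germ _ _ Hh). apply germ_sym.
  (* With [a] written as [transport K n n a], the label [next K n a] becomes a transport from [n] to
     [S n]. *)
  rewrite <- (transport_id K a (le_n n)) at 2.
  rewrite <- transport_S by auto. apply germ_transport. auto.
Qed.

Lemma worlds_of_atom (Var : Type) (K : chain Var) n a b c :
  In ⟨a, b ▷ c⟩ (atoms (stage K n)) ->
  exists h1 h2 h3 : limit_world K, rep h1 n a /\ rep h2 n b /\ rep h3 n c.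
Proof.
  intros H. destruct (sat_U (stage_saturates K n) H) as (Ha & Hb & Hc).
  apply world_of_next in Ha, Hb, Hc. firstorder.
Qed.

(** * The limit frame *)

Definition limit_rel (Var : Type) (K : chain Var) (h1 h2 h3 : limit_world K) : Prop :=
  exists n a b c, In ⟨a, b ▷ c⟩ (atoms (stage K n)) /\
    rep h1 n a /\ rep h2 n b /\ rep h3 n c.

Lemma limit_rel_intro (Var : Type) (K : chain Var) (h1 h2 h3 : limit_world K)
    n a b c :
  In ⟨a, b ▷ c⟩ (atoms (stage K n)) -> rep h1 n a -> rep h2 n b -> rep h3 n c ->
  limit_rel h1 h2 h3.
Proof. intros. exists n, a, b, c. auto. Qed.

Lemma rep_eps_all (Var : Type) (K : chain Var) (e : limit_world K) n :
  rep e 0 LEps -> rep e n LEps.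
Proof.
  intros H. apply (rep_transport (Nat.le_0_l n)) in H.
  now rewrite transport_eps in H by lia.
Qed.

Lemma limit_comm (Var : Type) (K : chain Var) (h1 h2 h3 : limit_world K) :
  limit_rel h1 h2 h3 -> limit_rel h2 h1 h3.
Proof.
  intros (n & a & b & c & H & Ra & Rb & Rc).
  apply (sat_E (stage_saturates K n)) in H.
  exists (S n), (next K n b), (next K n a), (next K n c). split; [exact H|].
  auto using rep_next.
Qed.

(** From left to right, once the label of [e] has become [LEps], the commuted atom falls under Eq,
    which merges the two other labels. From right to left, a world comes with a U atom by
    construction. *)
Lemma limit_identity (Var : Type) (K : chain Var) (e h1 h2 : limit_world K) :
  rep e 0 LEps -> limit_rel h1 e h2 <-> h1 = h2.
Proof.
  intros He. split.
  - intros H. apply limit_comm in H.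
    destruct H as (n & x & a & b & H & Rx & Ra & Rb).
    destruct (rep_eventually_eq Rx He) as (k & Hk & _ & E).
    specialize (E k (le_n k)). rewrite transport_eps in E by lia.
    apply (transport_atom Hk) in H. rewrite E in H.
    apply (sat_Eq (stage_saturates K k)) in H.
    apply (rep_transport Hk), rep_next in Ra, Rb. rewrite H in Ra.
    exact (rep_inj Ra Rb).
  - intros <-. destruct (rep_exists h1) as (n & a & Ha & H).
    exists n, a, LEps, a. auto using rep_eps_all.
Qed.

(** The two atoms may stem from different stages and labels. At a common stage where their first and
    third labels agree, C merges the second ones. *)
Lemma limit_cancel (Var : Type) (K : chain Var) (h1 h2 h3 h4 : limit_world K) :
  limit_rel h1 h2 h3 -> limit_rel h1 h4 h3 -> h2 = h4.
Proof.
  intros (n & a & b & c & H & Ra & Rb & Rc) (m & a' & b' & c' & H' & Ra' & Rb' & Rc').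
  destruct (rep_eventually_eq Ra Ra') as (k1 & Hn1 & Hm1 & E1).
  destruct (rep_eventually_eq Rc Rc') as (k2 & Hn2 & Hm2 & E2).
  pose (k := Nat.max k1 k2).
  assert (Hn : n <= k) by lia. assert (Hm : m <= k) by lia.
  specialize (E1 k). specialize (E2 k).
  apply (transport_atom Hn) in H. apply (transport_atom Hm) in H'.
  rewrite <- E1, <- E2 in H' by lia.
  pose proof (sat_C (stage_saturates K k) H H') as E.
  apply (rep_transport Hn), rep_next in Rb.
  apply (rep_transport Hm), rep_next in Rb'.
  rewrite E in Rb. exact (rep_inj Rb Rb').
Qed.

Lemma limit_assoc (Var : Type) (K : chain Var) (h1 h2 h3 h4 h5 : limit_world K) :
  limit_rel h1 h5 h4 -> limit_rel h2 h3 h5 ->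
  exists h6, limit_rel h6 h3 h4 /\ limit_rel h1 h2 h6.
Proof.
  (* Rule A splits the first component of a product, while the frame condition splits the second. *)
  intros H1 H2. apply limit_comm in H1, H2.
  destruct H1 as (n & x & y & z & H1 & Rx & Ry & Rz).
  destruct H2 as (m & u & v & x' & H2 & Ru & Rv & Rx').
  destruct (rep_eventually_eq Rx Rx') as (k & Hn & Hm & E). specialize (E k (le_n k)).
  apply (transport_atom Hn) in H1. apply (transport_atom Hm) in H2.
  rewrite <- E in H2.
  destruct (sat_A (stage_saturates K k) H1 H2) as (w & Hw1 & Hw2).
  apply (rep_transport Hn), rep_next in Ry, Rz.
  apply (rep_transport Hm), rep_next in Ru, Rv.
  (* The label [w] introduced by A occurs in an atom, so U provides a world for it. *)
  destruct (worlds_of_atom Hw2) as (_ & _ & h6 & _ & _ & R6).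
  exists h6. split.
  - apply limit_comm. exact (limit_rel_intro Hw1 Ru R6 Rz).
  - exact (limit_rel_intro Hw2 Ry Rv R6).
Qed.

Definition limit_frame (Var : Type) (K : chain Var) (e : limit_world K) : frame :=
  Frame (@limit_rel Var K) e.

Lemma limit_frame_cancellative (Var : Type) (K : chain Var) (e : limit_world K) :
  rep e 0 LEps -> cancellative_frame (limit_frame e).
Proof.
  intros He. repeat split; simpl.
  - now apply limit_identity.
  - now apply limit_identity.
  - apply limit_comm.
  - apply limit_comm.
  - intros h1 h2 h3 h4 h5 (H1 & H2). exact (limit_assoc H1 H2).
  - intros h1 h2 h3 h4 (H1 & H2). exact (limit_cancel H1 H2).
Qed.

(** * The truth lemma *)

Definition limit_val (Var : Type) (K : chain Var) (e : limit_world K)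
    (p : Var) (h : world (limit_frame e)) : Prop :=
  exists n a, @rep Var K h n a /\ In (a, CAtom p) (left (stage K n)).

Lemma realized_decomposed (Var : Type) (K : chain Var) n A b w :
  persistent b A = false -> realized (stage K n) A b w ->
  decomposed (stage K (S n)) A b (next K n w).
Proof.
  intros HA [H|H].
  - exact (sat_decomposed (stage_saturates K n) HA H).
  - exact (decomposed_extends _ _ _ (stage_extends K n) H).
Qed.

Lemma realized_persistent (Var : Type) (S : sequent Var) A b w :
  persistent b A = true -> realized S A b w -> In (w, A) (side b S).
Proof.
  intros HA [H|H]; auto. destruct A, b; try discriminate HA; destruct H.
Qed.

(** Induction on the formula for both sides at once, since implication and wand switch sides. A
    non-persistent formula is decomposed one stage later. A persistent one stays present, so it can
    be compared with semantic data from any stage after moving to a common later one. *)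
Lemma truth (Var : Type) (K : chain Var) (e : limit_world K) :
  rep e 0 LEps -> forall A b n w (h : limit_world K),
  rep h n w -> realized (stage K n) A b w ->
  if b then cforces (limit_frame e) (@limit_val Var K e) h A
  else ~ cforces (limit_frame e) (@limit_val Var K e) h A.
Proof.
  intros He.
  induction A as [p| | |A IHA B IHB|A IHA B IHB| |A IHA B IHB|A IHA B IHB];
    intros [] n w h Rh H.
  - apply realized_persistent in H; auto. exists n, w. auto.
  - apply realized_persistent in H; auto. intros (m & w' & Rh' & H').
    (* At a common stage the atom stands on both sides under the same label, which [r_id]
       excludes. *)
    destruct (rep_eventually_eq Rh Rh') as (k & Hn & Hm & E).
    specialize (E k (le_n k)).
    apply (realized_in _ _ false), (transport_realized Hn),
      realized_persistent in H; auto.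
    apply (realized_in _ _ true), (transport_realized Hm),
      realized_persistent in H'; auto.
    rewrite E in H. simpl in H, H'.
    destruct (in_permutation _ _ H) as (l & HP).
    destruct (in_permutation _ _ H') as (l' & HP').
    apply (@stage_underivable _ K k).
    apply (repr_iff false (fun r => iff_refl _) HP' HP). apply r_id.
  - exact I.
  - apply realized_decomposed in H; auto.
  - apply realized_decomposed in H; auto.
  - simpl. auto.
  - apply realized_decomposed in H; auto. destruct H as (HA & HB).
    apply rep_next in Rh.
    split; [exact (IHA true _ _ _ Rh HA)|exact (IHB true _ _ _ Rh HB)].
  - apply realized_decomposed in H; auto. apply rep_next in Rh. intros (FA & FB).
    destruct H as [H|H];
      [exact (IHA false _ _ _ Rh H FA)|exact (IHB false _ _ _ Rh H FB)].
  - apply realized_decomposed in H; auto. apply rep_next in Rh. intros FA.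
    destruct H as [H|H];
      [destruct (IHA false _ _ _ Rh H FA)|exact (IHB true _ _ _ Rh H)].
  - apply realized_decomposed in H; auto. destruct H as (HA & HB).
    apply rep_next in Rh. intros F.
    exact (IHB false _ _ _ Rh HB (F (IHA true _ _ _ Rh HA))).
  - apply realized_decomposed in H; auto. apply rep_next in Rh. simpl in H.
    (* Decomposition has only added the atom [⟨LEps, w ▷ LEps⟩]; the label itself becomes [LEps] one
       stage later, through Eq. *)
    apply (sat_Eq (stage_saturates K (S n))) in H.
    pose proof (rep_eps_all (S (S n)) He) as He'.
    apply rep_next in Rh. rewrite H in Rh.
    rewrite (proj1 (stage_extends K (S n))) in Rh.
    exact (rep_inj Rh He').
  - simpl. intros ->. destruct (rep_eventually_eq Rh He) as (k & Hn & _ & E).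
    specialize (E k (le_n k)). rewrite transport_eps in E by lia.
    apply (transport_realized Hn), realized_persistent in H; auto.
    rewrite E in H. destruct (in_permutation _ _ H) as (l & HP).
    apply (@stage_underivable _ K k).
    apply (repr_iff false (fun r => iff_refl _) (Permutation_refl _) HP).
    apply r_empR.
  - apply realized_decomposed in H; auto. apply rep_next in Rh.
    destruct H as (x & y & H & HA & HB).
    destruct (worlds_of_atom H) as (h1 & h2 & _ & R1 & R2 & _).
    exists h1, h2. split; [|split].
    + exact (limit_rel_intro H R1 R2 Rh).
    + exact (IHA true _ _ _ R1 HA).
    + exact (IHB true _ _ _ R2 HB).
  - intros (h1 & h2 & (m & a & b & c & HG & Ra & Rb & Rc) & FA & FB).
    (* The product [h1 h2 = h] is witnessed at stage [m], the star at stage [n]. At stage [k] they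
       share the label of [h], and the star is still on the right, so saturation under *R
       applies. *)
    destruct (rep_eventually_eq Rh Rc) as (k & Hn & Hm & E). specialize (E k (le_n k)).
    apply (transport_atom Hm) in HG.
    apply (transport_realized Hn), realized_persistent in H; auto.
    rewrite E in H.
    apply (rep_transport Hm), rep_next in Ra, Rb.
    destruct (sat_starR (stage_saturates K k) HG H) as [HA|HB].
    + exact (IHA false _ _ _ Ra HA FA).
    + exact (IHB false _ _ _ Rb HB FB).
  - intros h1 h2 HR FA. apply limit_comm in HR.
    destruct HR as (m & a & b & c & HG & Ra & Rb & Rc).
    destruct (rep_eventually_eq Rh Rb) as (k & Hn & Hm & E). specialize (E k (le_n k)).
    apply (transport_atom Hm) in HG.
    apply (transport_realized Hn), realized_persistent in H; auto.
    rewrite E in H.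
    apply (rep_transport Hm), rep_next in Ra, Rc.
    destruct (sat_wandL (stage_saturates K k) HG H) as [HA|HB].
    + destruct (IHA false _ _ _ Ra HA FA).
    + exact (IHB true _ _ _ Rc HB).
  - apply realized_decomposed in H; auto. apply rep_next in Rh.
    destruct H as (x & y & H & HA & HB). intros F.
    destruct (worlds_of_atom H) as (h1 & _ & h2 & R1 & _ & R2).
    apply (IHB false _ _ _ R2 HB), (F h1).
    + apply limit_comm. exact (limit_rel_intro H R1 Rh R2).
    + exact (IHA true _ _ _ R1 HA).
Qed.

(** * Completeness and the theorem *)

Lemma completeness (Var : Type) (A : cform Var) (w : lvar) :
  (forall (M : frame) (nu : Var -> world M -> Prop) h,
     cancellative_frame M -> cforces M nu h A) ->
  LSBBI_C false [] [] [(LVar w, A)].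
Proof.
  intros HV. apply NNPP. intros U.
  (* Two applications of U give both [LVar w] and [LEps] an atom at stage 0, so that each represents
     a world of the limit from the start. *)
  pose (S0 := Seq [⟨LVar w, LEps ▷ LVar w⟩; ⟨LEps, LEps ▷ LEps⟩] [] [(LVar w, A)]).
  assert (U0 : underivable S0).
  { intros D. apply U. apply (r_U (x := LEps)), (r_U (x := LVar w)), D. }
  destruct (chain_exists U0) as (K & EK).
  destruct (@world_of_label Var K 0 LEps) as (e & He); [rewrite EK; simpl; auto|].
  destruct (@world_of_label Var K 0 (LVar w)) as (h & Hh); [rewrite EK; simpl; auto|].
  refine (@truth _ K e He A false 0 (LVar w) h Hh _
            (HV (limit_frame e) _ h (limit_frame_cancellative He))).
  rewrite EK. apply realized_in. simpl; auto.
Qed.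

Theorem mainTheorem15 (Var : Type) (F : form Var) :
  ((exists w : lvar, LSBBI_C true [] [] [(LVar w, unabbrev F)]) ->
     valid_cancellative F)
  /\
  (valid_cancellative F ->
     exists w : lvar, LSBBI_C false [] [] [(LVar w, unabbrev F)]).
Proof.
  split.
  - intros (w & D) M HM nu h. apply cforces_unabbrev.
    (* The end sequent contains a single label, so all variables may be sent to [h]. *)
    pose (rho := fun l => match l with LVar _ => h | LEps => frame_eps M end).
    assert (HE := soundness D HM (nu := nu) (rho := rho) eq_refl (Forall_nil _) (Forall_nil _)).
    apply Exists_cons in HE. destruct HE as [HE|HE]; [exact HE|inversion HE].
  - intros HV. exists 0. apply completeness. intros M nu h HM.
    apply cforces_unabbrev. now apply HV.
Qed.
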